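(* Let $Sp(K,S)$ be a split graph with $|K|\ge 2$ and biadjacency matrix $R$. Then: (1) If $(x_K,x_S)^t\in\mathcal{N}(Sp)$, then $x_K\in\operatorname{Cker}(Sp)$. (2) For each $x\in\operatorname{Cker}(Sp)$ there exists $y\in\mathbb{R}^{|S|}$ such that $(x,y)^t\in\mathcal{N}(Sp)$. (3) $\operatorname{Supp}(Sp)\subseteq S$ if and only if $\operatorname{Cker}(Sp)=\{0\}$. (4) If $Sp$ is singular, then $\operatorname{Supp}(Sp)\cap S\ne\varnothing$.
   Context: Graphs are finite and simple. A split graph is a graph $Sp$ whose vertex set is a disjoint union of a clique $K$ and an independent set $S$; the pair $(K,S)$ is called an s-partition, and $Sp(K,S)$ denotes $Sp$ together with this s-partition. Both $K$ and $S$ are assumed nonempty. With the vertices ordered as $(K,S)$, the adjacency matrix is \[A(Sp)=\begin{pmatrix} J-I & R\\ R^t & 0\end{pmatrix},\] where $J$ is an all-ones matrix, $I$ the identity, and $R$ is the $|K|\times|S|$ $0/1$ biadjacency matrix ($R_{uv}=1$ iff $u\in K$ and $v\in S$ are adjacent). Vectors indexed by $V(Sp)$ are written $(x_K,x_S)$ with $x_K\in\mathbb{R}^{|K|}$, $x_S\in\mathbb{R}^{|S|}$. $\mathcal{N}(A)$ and $\operatorname{im}(A)$ are the nullspace and column space of a real matrix $A$, and $\mathcal{N}(Sp)=\mathcal{N}(A(Sp))$. A graph is singular if its adjacency matrix is singular. $\operatorname{Supp}(Sp)$ is the set of vertices $v$ such that $x_v\ne 0$ for some $x\in\mathcal{N}(Sp)$.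 For $|K|\ge 2$ the matrix $I-J$ of order $|K|$ is invertible, and the clique-kernel is $\operatorname{Cker}(Sp)=\mathcal{N}(R^t)\cap\operatorname{im}((I-J)^{-1}R)\subseteq\mathbb{R}^{|K|}$. *)

(* Defs.v *)
From HB Require Import structures.
From mathcomp Require Import all_boot all_order all_algebra.
From mathcomp Require Import boolp classical_sets reals.

Set Implicit Arguments.
Unset Strict Implicit.
Unset Printing Implicit Defensive.

Import Order.TTheory GRing.Theory Num.Theory.

Local Open Scope classical_set_scope.
Local Open Scope ring_scope.

Record sgraph := SGraph {
  vertex :> finType;
  adj : rel vertex;
  adj_sym : symmetric adj;
  adj_irrefl : irreflexive adj
}.

Definition clique (G : sgraph) (K : {set G}) : Prop :=
  forall u v : G, u \in K -> v \in K -> u != v -> adj u v.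

Definition independent (G : sgraph) (S : {set G}) : Prop :=
  forall u v : G, u \in S -> v \in S -> ~~ adj u v.

Definition s_partition (G : sgraph) (K S : {set G}) : Prop :=
  [/\ (K :|: S)%SET = [set: G]%SET & (K :&: S)%SET = finset.set0] /\
  [/\ K != finset.set0, S != finset.set0, clique K & independent S].

Section SplitGraph.
Variables (R : realType) (G : sgraph) (K S : {set G}).

(* The vertex at position i when the vertices are listed as (K, S). This is
   a bijection onto G as soon as (K, S) is an s-partition. *)
Definition ks_vertex (i : 'I_(#|K| + #|S|)) : G :=
  match split i with
  | inl a => enum_val a
  | inr b => enum_val b
  end.

Definition adjmx : 'M[R]_(#|K| + #|S|) :=
  \matrix_(i, j) (adj (ks_vertex i) (ks_vertex j))%:R.

Definition biadjmx : 'M[R]_(#|K|, #|S|) :=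
  \matrix_(i, j) (adj (enum_val i) (enum_val j))%:R.

End SplitGraph.

(* Nullspace and column space, as sets of column vectors (the subspaces of
   mxalgebra are spaces of row vectors). *)
Definition nullspace (R : realType) (m n : nat) (A : 'M[R]_(m, n)) :
    set 'cV[R]_n :=
  [set x | A *m x = 0].

Definition colspace (R : realType) (m n : nat) (A : 'M[R]_(m, n)) :
    set 'cV[R]_m :=
  [set A *m y | y in [set: 'cV[R]_n]].

Definition Supp (R : realType) (G : sgraph) (K S : {set G}) : set G :=
  [set v | exists (x : 'cV[R]_(#|K| + #|S|)) (i : 'I_(#|K| + #|S|)),
     [/\ nullspace (adjmx R K S) x, ks_vertex i = v & x i 0 != 0]].

(* invmx is the inverse only on invertible matrices: this is the clique-kernel
   when 2 <= #|K|. *)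
Definition Cker (R : realType) (G : sgraph) (K S : {set G}) :
    set 'cV[R]_#|K| :=
  nullspace (biadjmx R K S)^T `&`
  colspace (invmx (1%:M - const_mx 1) *m biadjmx R K S).
Arguments Cker R [G] K S.

(* Main.v *)
Require Import Defs.
From HB Require Import structures.
From mathcomp Require Import all_boot all_order all_algebra.
From mathcomp Require Import boolp classical_sets reals.

Set Implicit Arguments.
Unset Strict Implicit.
Unset Printing Implicit Defensive.

Import Order.TTheory GRing.Theory Num.Theory.

Local Open Scope classical_set_scope.
Local Open Scope ring_scope.

(* Write [M = I - J], which is invertible when [K] has at least two vertices.
   The block form of the adjacency matrix says that [(x, y)] is a null vector iff
   [M x = B y] and [B^T x = 0]; hence [x] ranges exactly over the clique-kernel, and
   [y = 0] forces [x = 0], so a nonzero null vector is nonzero somewhere on [S]. *)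

Section SplitGraphKernel.
Variables (R : realType) (G : sgraph) (K S : {set G}).
Hypothesis hKS : s_partition K S.

Local Notation B := (biadjmx R K S).
Local Notation M := (1%:M - const_mx 1 : 'M[R]_#|K|).

Lemma ks_vertex_lshift (i : 'I_#|K|) :
  ks_vertex (lshift #|S| i : 'I_(#|K| + #|S|)) = enum_val i.
Proof. by rewrite /ks_vertex -[lshift _ i]/(unsplit (inl i)) unsplitK. Qed.

Lemma ks_vertex_rshift (j : 'I_#|S|) :
  ks_vertex (rshift #|K| j : 'I_(#|K| + #|S|)) = enum_val j.
Proof. by rewrite /ks_vertex -[rshift _ j]/(unsplit (inr j)) unsplitK. Qed.

(** The clique block is [J - I], that is [- M]: irreflexivity of [adj] gives its zero diagonal and
    the clique property its off-diagonal ones. Independence of [S] gives the zero block. *)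
Lemma adjmx_block : adjmx R K S = block_mx (- M) B B^T 0.
Proof.
case: hKS => _ [_ _ cK iS].
apply/matrixP => i j; rewrite -[i]splitK -[j]splitK.
case: (split i) => a; case: (split j) => b /=.
- rewrite block_mxEul !mxE !ks_vertex_lshift opprB.
  have [->|neq_ab] := eqVneq a b; first by rewrite adj_irrefl subrr.
  by rewrite subr0 cK ?enum_valP // (inj_eq enum_val_inj).
- by rewrite block_mxEur !mxE ks_vertex_lshift ks_vertex_rshift.
- by rewrite block_mxEdl !mxE ks_vertex_lshift ks_vertex_rshift adj_sym.
- rewrite block_mxEdr !mxE !ks_vertex_rshift.
  by rewrite (negbTE (iS _ _ _ _)) ?enum_valP.
Qed.

Lemma nullspace_adjmxP (x : 'cV[R]_#|K|) (y : 'cV[R]_#|S|) :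
  nullspace (adjmx R K S) (col_mx x y) <-> M *m x = B *m y /\ B^T *m x = 0.
Proof.
rewrite /nullspace /= adjmx_block mul_block_col mul0mx addr0 mulNmx addrC.
split=> [/eqP|[-> ->]]; last by rewrite subrr col_mx0.
by rewrite col_mx_eq0 subr_eq0 => /andP[/eqP -> /eqP ->].
Qed.

Lemma s_partition_disjoint (v : G) : v \in K -> v \in S -> False.
Proof.
case: hKS => -[_ KS0] _ vK vS.
by have := finset.in_set0 v; rewrite -KS0 finset.in_setI vK vS.
Qed.

End SplitGraphKernel.

Lemma unitmx_scalar_sub_ones (F : numFieldType) (n : nat) :
  (2 <= n)%N -> (1%:M - const_mx 1 : 'M[F]_n) \in unitmx.
Proof.
(* With [J] the all-ones matrix, the inverse is [I - J / (n - 1)]. *)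
move=> n2; pose c : F := n.-1%:R^-1; pose J : 'M[F]_n := const_mx 1.
have n1_neq0 : n.-1%:R != 0 :> F.
  by rewrite pnatr_eq0 -lt0n -ltnS prednK // ltnW.
have JJ : J *m J = n%:R *: J.
  apply/matrixP => i j; rewrite !mxE mulr1.
  under eq_bigr => k _ do rewrite !mxE mulr1.
  by rewrite sumr_const card_ord.
suff /mulmx1_unit[] : (1%:M - J) *m (1%:M - c *: J) = 1%:M by [].
rewrite mulmxBl mul1mx mulmxBr mulmx1 -scalemxAr JJ scalerA.
(* Since [c] inverts [n - 1], this makes the coefficient of [J] in the product, [c * n - c - 1],
   vanish. *)
have -> : c * n%:R = c + 1.
  by rewrite -[in LHS](prednK (ltnW n2)) -natr1 mulrDr mulr1 mulVf // addrC.
by rewrite scalerDl scale1r addrC opprB addrK addrC subrK.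
Qed.

Lemma singular_nullspace (R : realType) (n : nat) (A : 'M[R]_n) :
  A \notin unitmx -> exists2 x, x != 0 & nullspace A x.
Proof.
(* [det0P] yields a row vector killed on the left, so it is applied to the transpose of [A]. *)
rewrite -unitmx_tr unitmxE unitfE negbK => /det0P[v v0 vA].
exists v^T; first by rewrite -(inj_eq trmx_inj) trmxK trmx0.
by apply: trmx_inj; rewrite trmx_mul trmxK trmx0.
Qed.

Lemma cV_neq0P (V : nmodType) (n : nat) (x : 'cV[V]_n) :
  x != 0 -> exists i, x i 0 != 0.
Proof.
move=> x0; apply: contra_notP (elimN eqP x0) => /forallNP nx.
by apply/colP => i; rewrite mxE; apply/eqP/negPn/negP/nx.
Qed.

Theorem theorem3p4 (R : realType) (G : sgraph) (K S : {set G})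
    (hKS : s_partition K S) (hK : (2 <= #|K|)%N) :
  [/\ forall (xK : 'cV[R]_#|K|) (xS : 'cV[R]_#|S|),
        nullspace (adjmx R K S) (col_mx xK xS) -> Cker R K S xK,
      forall x : 'cV[R]_#|K|, Cker R K S x ->
        exists y : 'cV[R]_#|S|, nullspace (adjmx R K S) (col_mx x y),
      Supp R K S `<=` [set` S] <-> Cker R K S = [set 0] &
      adjmx R K S \notin unitmx -> Supp R K S `&` [set` S] !=set0].
Proof.
set M : 'M[R]_#|K| := 1%:M - const_mx 1.
have uM : M \in unitmx by exact: unitmx_scalar_sub_ones.
have H1 (xK : 'cV[R]_#|K|) (xS : 'cV[R]_#|S|) :
    nullspace (adjmx R K S) (col_mx xK xS) -> Cker R K S xK.
  move=> /(nullspace_adjmxP hKS)[eqMB eqB0]; split=> //.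
  (* Inverting [M] in [M *m xK = B *m xS] shows that [xS] itself witnesses membership in the column
     space. *)
  by exists xS => //; rewrite -mulmxA -eqMB mulKmx.
have H2 (x : 'cV[R]_#|K|) : Cker R K S x ->
    exists y : 'cV[R]_#|S|, nullspace (adjmx R K S) (col_mx x y).
  move=> [Bx0 [y _ xE]]; exists y; apply/(nullspace_adjmxP hKS); split=> //.
  by rewrite -xE -mulmxA mulKVmx.
split=> //.
- split=> [suppS|cker0 v [x [i [x0 <- xi]]]].
    apply/seteqP; split=> [x /[dup] ckx /H2[y xy0] /=|x ->].
      (* A nonzero entry of [x] would put a vertex of [K] into the support, hence into [S], against
         disjointness. *)
      apply/eqP; apply: contraT => /cV_neq0P[i xi].
      have /suppS /= : Supp R K S (enum_val i).
        exists (col_mx x y), (lshift _ i).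
        by split=> //; [exact: ks_vertex_lshift|rewrite col_mxEu].
      by move/(s_partition_disjoint hKS (enum_valP i)).
    (* The zero null vector shows that [0] lies in the clique-kernel. *)
    apply: (H1 0 0); apply/(nullspace_adjmxP hKS).
    by rewrite !mulmx0.
  (* If [i] indexes a vertex of [K], the entry there belongs to a clique-kernel vector, so it is
     zero; hence [i] indexes a vertex of [S]. *)
  move: x0 xi; rewrite -[x]vsubmxK -[i]splitK.
  case: (split i) => j /= x0.
    have : Cker R K S (usubmx x) by exact: H1 x0.
    by rewrite cker0 => /= ->; rewrite col_mxEu mxE eqxx.
  by rewrite ks_vertex_rshift => _; exact: enum_valP.
- move=> /singular_nullspace[x]; rewrite -[x]vsubmxK => xN0 x0.
  have /cV_neq0P[j xj] : dsubmx x != 0.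
    apply: contra_neq xN0 => xS0.
    have [MxK _] := (nullspace_adjmxP hKS _ _).1 x0.
    have -> : usubmx x = 0 by rewrite -[usubmx x](mulKmx uM) MxK xS0 !mulmx0.
    by rewrite xS0 col_mx0.
  exists (enum_val j); split; last exact: enum_valP.
  exists (col_mx (usubmx x) (dsubmx x)), (rshift _ j).
  by split=> //; [exact: ks_vertex_rshift|rewrite col_mxEd].
Qed.
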